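(* Let $n\in\mathbb{N}\setminus\{1,2\}$ and let $\Lambda_n(t,W)\in\mathcal{M}(\mathcal{O}_n)$ be a cyclotomic model set. Further, let $U\subset\mathbb{S}^1$ be any set of $k+1$ pairwise non-parallel $\mathcal{O}_n$-directions, where $k\in\mathbb{N}_0=\{0,1,2,\dots\}$. Then, $\mathcal{F}_{\leq k}(\Lambda_n(t,W))$ is determined by the $X$-rays in the directions of $U$.
   Context: Identify $\mathbb{C}$ with $\mathbb{R}^2$. Let $\zeta_n=e^{2\pi i/n}$, $\mathbb{K}_n=\mathbb{Q}(\zeta_n)$, $\mathcal{O}_n=\mathbb{Z}[\zeta_n]$, and let $\phi$ be Euler's totient function. Cyclotomic model sets. For $n\in\mathbb{N}\setminus\{1,2\}$, choose exactly one automorphism from each pair of complex conjugate automorphisms in $\mathrm{Gal}(\mathbb{K}_n/\mathbb{Q})$, obtaining $\sigma_1=\mathrm{id},\sigma_2,\dots,\sigma_{\phi(n)/2}$. The associated star map $\star:\mathcal{O}_n\to(\mathbb{R}^2)^{\phi(n)/2-1}$ is $z\mapsto(\sigma_2(z),\dots,\sigma_{\phi(n)/2}(z))$; if $n\in\{3,4,6\}$, $(\mathbb{R}^2)^{0}$ is the trivial group $\{0\}$ and the star map is $0$. A window is a set $W\subset(\mathbb{R}^2)^{\phi(n)/2-1}$ with $\varnothing\neq W^\circ\subset W\subset\overline{W^\circ}$ and $\overline{W^\circ}$ compact. For a window $W$ and $t\in\mathbb{R}^2$ set $\Lambda_n(t,W)=t+\{z\in\mathcal{O}_n : z^\star\in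 W\}$. $\mathcal{M}(\mathcal{O}_n)$ is the collection of all sets $\Lambda_n(t,W)$ (all $t$, all windows $W$, all choices of star map); its elements are called cyclotomic model sets. $\mathcal{F}_{\leq k}(S)$ denotes the set of all finite subsets of $S\subset\mathbb{R}^2$ having cardinality at most $k$. A direction is an element of $\mathbb{S}^1$; an $\mathcal{O}_n$-direction is a direction parallel to a non-zero element of $\mathcal{O}_n$. For a finite $F\subset\mathbb{R}^2$ and a direction $u$, the $X$-ray $X_uF$ is the function assigning to each line $\ell$ parallel to $u$ the number $\operatorname{card}(F\cap\ell)$. A collection $\mathcal{E}$ of finite subsets of $\mathbb{R}^2$ is determined by the $X$-rays in the directions of a finite set $U$ of directions if for all $F,F'\in\mathcal{E}$: $(X_uF=X_uF'\ \forall u\in U)\Rightarrow F=F'$. *)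

(* Defs.v *)
(* The plane R^2, identified with the complex numbers, is R[i] for
   R : realType. *)
From HB Require Import structures.
From mathcomp Require Import all_boot all_order all_algebra.
From mathcomp Require Import complex finmap.
From mathcomp Require Import all_classical all_reals all_analysis.

Set Implicit Arguments.
Unset Strict Implicit.
Unset Printing Implicit Defensive.

Import Order.TTheory GRing.Theory Num.Theory.
Import numFieldNormedType.Exports.

Local Open Scope classical_set_scope.
Local Open Scope ring_scope.
Local Open Scope complex_scope.

(* R[i] receives the topology of its norm (that of R[i] as a numFieldType),
   hence 'rV[R[i]]_m the product topology. *)
HB.instance Definition _ (R : realType) :=
  PseudoPointedMetric.copy R[i] (R[i])^o.

Section CyclotomicField.
Variables (R : realType) (n : nat).

Definition zeta : R[i] :=
  cos (2 * pi / n%:R) +i* sin (2 * pi / n%:R).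

Definition cyclotomic_field : {pred R[i]} := fun x =>
  `[< exists p q : {poly rat},
        (map_poly ratr q).[zeta] != 0 /\
        x = (map_poly ratr p).[zeta] / (map_poly ratr q).[zeta] >].

Definition cyclotomic_integer : set R[i] :=
  [set x | exists p : {poly int}, x = (map_poly intr p).[zeta]].

Lemma cyclotomic_field_divring : GRing.divring_closed cyclotomic_field.
Proof.
split.
- apply/asboolP; exists 1, 1.
  by rewrite rmorph1 hornerC oner_eq0 divr1.
- move=> x y /asboolP[p [q [q0 ->]]] /asboolP[r [s [s0 ->]]].
  apply/asboolP; exists (p * s - r * q), (q * s).
  by rewrite rmorphB !rmorphM !hornerE mulf_neq0 // -mulNr addf_div // mulNr.
- move=> x y /asboolP[p [q [q0 ->]]] /asboolP[r [s [s0 ->]]].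
  apply/asboolP; have [r0|r0] := eqVneq (map_poly ratr r).[zeta] 0.
    exists 0, 1; rewrite rmorph0 rmorph1 !hornerC oner_eq0.
    by rewrite r0 !mul0r invr0 mulr0.
  exists (p * s), (q * r); rewrite !rmorphM !hornerE mulf_neq0 //.
  by rewrite invf_div mulf_div.
Qed.

HB.instance Definition _ :=
  GRing.isDivringClosed.Build R[i] cyclotomic_field cyclotomic_field_divring.

Record cyclotomic : Type := Cyclotomic {
  cyclotomic_val :> R[i];
  _ : cyclotomic_val \in cyclotomic_field }.

HB.instance Definition _ := [isSub for cyclotomic_val].
HB.instance Definition _ := [Choice of cyclotomic by <:].
HB.instance Definition _ := [SubChoice_isSubComUnitRing of cyclotomic by <:].
HB.instance Definition _ :=
  [SubComUnitRing_isSubIntegralDomain of cyclotomic by <:].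
HB.instance Definition _ := [SubIntegralDomain_isSubField of cyclotomic by <:].

End CyclotomicField.

Section ModelSets.
Variables (R : realType) (n : nat).

(* The dimension totient n / 2 - 1 of the internal space, for n > 2. *)
Definition internal_dim : nat := ((totient n)./2).-1.

(* The family s is indexed from 0 and, for n > 2, has internal_dim.+1 =
   totient n / 2 members.  Automorphisms over the rationals are just field
   automorphisms, i.e. bijective ring morphisms. *)
Definition conj_pair_representatives
    (s : 'I_internal_dim.+1 -> {rmorphism cyclotomic R n -> cyclotomic R n}) :=
  [/\ forall j, bijective (s j),
      s ord0 =1 id &
      forall t : {rmorphism cyclotomic R n -> cyclotomic R n}, bijective t ->
        exists! j, (forall z, s j z = t z :> R[i]) \/
                   (forall z, s j z = (t z : R[i])^* :> R[i])].

Definition star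
    (s : 'I_internal_dim.+1 -> {rmorphism cyclotomic R n -> cyclotomic R n})
    (z : cyclotomic R n) : 'rV[R[i]]_internal_dim :=
  \row_j (s (lift ord0 j) z : R[i]).

Definition window (W : set 'rV[R[i]]_internal_dim) :=
  [/\ W° !=set0, W `<=` closure W° & compact (closure W°)].

Definition model_set
    (s : 'I_internal_dim.+1 -> {rmorphism cyclotomic R n -> cyclotomic R n})
    (t : R[i]) (W : set 'rV[R[i]]_internal_dim) : set R[i] :=
  [set t + (z : R[i]) |
    z in [set z : cyclotomic R n | cyclotomic_integer n (z : R[i])
                                   /\ W (star s z)]].

Definition cyclotomic_model_sets : set (set R[i]) :=
  [set L | exists s t W,
     [/\ conj_pair_representatives s, window W & L = model_set s t W]].

End ModelSets.

Section XRays.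
Variable R : realType.

Definition finite_subsets_le (k : nat) (S : set R[i]) : set {fset R[i]} :=
  [set F : {fset R[i]} | [set` F] `<=` S /\ (#|` F| <= k)%N].

Definition direction (u : R[i]) := `|u| = 1.

(* Meant for nonzero u and v. *)
Definition parallel (u v : R[i]) := exists c : R, u = c%:C * v.

Definition cyclotomic_direction (n : nat) (u : R[i]) :=
  direction u /\
  exists z : R[i], [/\ cyclotomic_integer n z, z != 0 & parallel u z].

Definition lines_along (u : R[i]) : set (set R[i]) :=
  [set l | exists a, l = [set a + c%:C * u | c in [set: R]]].

Definition xray (u : R[i]) (F : {fset R[i]}) (l : lines_along u) : nat :=
  #|` [fset x in F | x \in val l]%fset|.

Definition determined_by_xrays (E : set {fset R[i]}) (U : {fset R[i]}) :=
  forall F F' : {fset R[i]}, E F -> E F' ->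
    (forall u, u \in U -> @xray u F =1 @xray u F') -> F = F'.

End XRays.

(* Main.v *)
Require Import Defs.
From mathcomp Require Import all_boot all_order all_algebra.
From mathcomp Require Import complex finmap.
From mathcomp Require Import all_classical all_reals all_analysis.

(** A point [x] of [F] outside [F'] has, on each of the [k+1] lines through it
in the directions of [U], a point of [F'], because these lines carry equally
many points of [F] and of [F'].  Distinct lines through [x] meet only in [x],
and [x] is not in [F'], so these points of [F'] are pairwise distinct and [F']
has at least [k+1] points ([card_ge_directions]).  Hence two sets of at most
[k] points with equal X-rays contain one another. *)

Import GRing.Theory.

Local Open Scope classical_set_scope.
Local Open Scope ring_scope.
Local Open Scope complex_scope.

(** The line through [x] carries [x] itself, so its X-ray value is positive
for [F], hence for [F']. *)
Lemma xray_eq_meets_line (R : realType) (u x : R[i]) (F F' : {fset R[i]}) :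
  @xray R u F =1 @xray R u F' -> x \in F ->
  exists2 y, y \in F' & exists c : R, y = x + c%:C * u.
Proof.
move=> eqX xF.
have lP : [set x + c%:C * u | c in [set: R]] \in lines_along u.
  by apply/mem_set; exists x.
have := eqX (SigSub lP); rewrite /xray /= => eq_card.
have : (0 < #|` [fset z in F' |
    z \in [set (x + c%:C * u)%R | c in [set: R]]]%fset|)%N.
  rewrite -eq_card cardfs_gt0; apply/fset0Pn; exists x.
  rewrite !inE xF /=; apply/mem_set; exists 0 => //.
  by rewrite mul0r addr0.
rewrite cardfs_gt0 => /fset0Pn[y]; rewrite !inE /= => /andP[yF' /set_mem[c _ yE]].
by exists y => //; exists c.
Qed.

(** This is the fact that two lines through [x] sharing a second point
coincide, put in terms of their direction vectors. *)
Lemma parallel_of_common_point (R : realType) (u v x : R[i]) (c d : R) :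
  x + c%:C * u != x -> x + c%:C * u = x + d%:C * v -> parallel u v.
Proof.
move=> neq /addrI eq_cd; have c0 : c%:C != 0.
  by apply: contraNneq neq => ->; rewrite mul0r addr0.
by exists (c^-1 * d); rewrite rmorphM fmorphV -mulrA -eq_cd mulKf.
Qed.

(** Choosing a point of [F'] on each line through [x] gives an injection of
[U] into [F']; since [x \notin F'], a chosen point differs from [x], so it lies on
no second such line. *)
Lemma card_ge_directions (R : realType) (U F F' : {fset R[i]}) (x : R[i]) :
  (forall u v, u \in U -> v \in U -> u != v -> ~ parallel u v) ->
  (forall u, u \in U -> @xray R u F =1 @xray R u F') ->
  x \in F -> x \notin F' -> (#|` U| <= #|` F'|)%N.
Proof.
move=> Upar eqX xF xF'.
pose on_line u y := y \in F' /\ exists c : R, y = x + c%:C * u.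
pose g u := xget 0 [set y | on_line u y].
have gP u : u \in U -> on_line u (g u).
  move=> /eqX/xray_eq_meets_line/(_ xF)[y yF' yl].
  exact: (xgetPex 0 (ex_intro [set y | on_line u y] y (conj yF' yl))).
have g_inj : {in U &, injective g}.
  move=> u v uU vU guv; apply/eqP; apply: contraT => /(Upar _ _ uU vU)[].
  have [guF' [c gu]] := gP u uU; have [_ [d gv]] := gP v vU.
  apply: (@parallel_of_common_point _ u v x c d); last by rewrite -gu guv.
  by rewrite -gu; apply: contraNneq xF' => <-.
rewrite -(card_in_imfset imfset_key g_inj); apply: fsubset_leq_card.
by apply/fsubsetP => _ /imfsetP[u /= uU ->]; have [] := gP u uU.
Qed.

Theorem proposition9 (R : realType) (n : nat) (hn : (2 < n)%N)
    (L : set R[i]) (hL : cyclotomic_model_sets n L)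
    (k : nat) (U : {fset R[i]}) (hUcard : #|` U| = k.+1)
    (hUdir : forall u, u \in U -> cyclotomic_direction n u)
    (hUpar : forall u v, u \in U -> v \in U -> u != v -> ~ parallel u v) :
  determined_by_xrays (finite_subsets_le k L) U.
Proof.
have sub (F F' : {fset R[i]}) : (#|` F'| <= k)%N ->
    (forall u, u \in U -> @xray R u F =1 @xray R u F') -> (F `<=` F')%fset.
  move=> F'k eqX; apply/fsubsetP => x xF; apply: contraT => xF'.
  have := card_ge_directions _ _ _ _ _ hUpar eqX xF xF'.
  by rewrite hUcard leqNgt ltnS F'k.
move=> F F' [_ Fk] [_ F'k] eqX; apply/eqP; rewrite eqEfsubset.
rewrite (sub _ _ F'k eqX) sub // => u uU l.
by rewrite eqX.
Qed.
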